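(* Let $X$ be a set and let $\lim:\mathbb{F}(V^X)\to V^X$ be a monotone map, so that $(V^X,\lim)$ is a convergence frame. Then there is an approach space $(X,\lambda)$ with $\lim=\lim_\lambda$ (that is, $(V^X,\lim)$ is an object of $V^{(-)}\text{-}\mathsf{Ap}$) if and only if $(V^X,\lim)$ is $**$-regular, centered, satisfies $$\lim\Big(\bigcap_{\mathcal D\in\mathbb D}\mathcal D\Big)=\bigwedge_{\mathcal D\in\mathbb D}\lim\mathcal D$$ for every nonempty $\mathbb D\subset\mathbb{F}(V^X)$, and also satisfies $$\lim\mathcal G(\cdot)\;\le\;\operatorname{adh}f(\cdot)\oslash\limsup_{(\operatorname{adh}f)^{\star}\mathcal G}\mathrm{id}_V$$ for every $f\in V^X$ and every $\mathcal G\in\mathbb{F}(V^X)$.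
   Context: Throughout, $V=[0,1]$ with its usual order and $\otimes$ is multiplication (equivalently, via $-\ln$, $V=[0,\infty]^{op}$ with $\otimes=+$). Division is $t\oslash x=\min(t/x,1)$ if $x\neq 0$ and $t\oslash 0=1$. For a lattice $L$, $\mathbb{F}L$ is the set of proper order-theoretic filters on $L$; in particular $\mathbb{F}\mathbb{P}X$ is the set of (set-theoretic) filters on $X$, where $\mathbb{P}X$ is the powerset. $V^X$ is a frame for the pointwise order. Approach spaces. A convergence approach space $(X,\lambda)$ is a set $X$ with a map $\lambda:\mathbb{F}\mathbb{P}X\to V^X$ such that $\mathcal F\subset\mathcal G$ implies $\lambda(\mathcal F)\le\lambda(\mathcal G)$, and $\lambda(\{x\}^{\uparrow})(x)=1$ for all $x$ ($\{x\}^\uparrow$ the principal ultrafilter). For $A\subset X$, $\operatorname{adh}_\lambda A(x)=\bigvee\{\lambda(\mathcal U)(x):\mathcal U\text{ an ultrafilter on }X,\ A\in\mathcal U\}$ and $A^{(\epsilon)}=\{x:\operatorname{adh}_\lambda A(x)\ge\epsilon\}$. It is a pre-approach space if $\lambda(\bigcap_{\mathcal D\in\mathbb D}\mathcal D)=\bigwedge_{\mathcal D\in\mathbb D}\lambda(\mathcal D)$ for every nonempty $\mathbb D\subset\mathbb{F}\mathbb{P}X$, and an approach space if moreover $\operatorname{adh}_\lambda A(x)\ge\operatorname{adh}_\lambda A^{(\epsilon)}(x)\otimes\epsilon$ for all $A\subset X$, $x\in X$, $\epsilon\in V$. Convergence frames. A convergence frame $(L,\lim)$ is a frame $L$ with a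 monotone map $\lim:\mathbb{F}L\to L$. To a convergence approach space $(X,\lambda)$ one associates the convergence frame $(V^X,\lim_\lambda)$ with $\lim_\lambda\mathcal F=\lambda(\{A\subset X:\theta_A\in\mathcal F\})$, where $\theta_A$ is the indicator function of $A$ ($1$ on $A$, $0$ off $A$). $V^{(-)}\text{-}\mathsf{Ap}$ is the class of all $(V^X,\lim_\lambda)$ with $(X,\lambda)$ an approach space. For $a\in L$, $a^*=\bigvee\{b\in L:a\wedge b=\bot\}$ is the pseudocomplement. For $\mathcal F\in\mathbb{F}L$, $\mathcal F^{**}\in\mathbb{F}L$ is the upward closure of $\{m^{**}:m\in\mathcal F\}$. $(L,\lim)$ is $**$-regular if $\lim\mathcal F=\lim(\mathcal F^{**})$ for all $\mathcal F\in\mathbb{F}L$. For $\ell\in L$, $\operatorname{adh}\ell=\bigvee\{\lim\mathcal H:\mathcal H\in\mathbb{F}L,\ h\wedge m\ne\bot\ \text{for all } h\in\mathcal H\text{ and all } m\ge\ell\}$ (with $\bigvee\emptyset=\bot$); $(L,\lim)$ is centered if $\operatorname{adh}\ell\ge\ell$ for all $\ell\in L$. For $h\in V^X$ and $\mathcal G\in\mathbb{F}(V^X)$, $h^{\star}\mathcal G=\{A\subset V:\theta_A\circ h\in\mathcal G\}$ (here $\theta_A:V\to V$ is the indicator function of $A\subset V$). For a family $\mathcal A$ of subsets of $V$, $\limsup_{\mathcal A}\mathrm{id}_V=\bigwedge_{A\in\mathcal A}\bigvee A$. *)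

(* Defs.v *)
From HB Require Import structures.
From mathcomp Require Import all_boot all_order all_algebra.
From mathcomp Require Import interval_inference.
From mathcomp Require Import boolp classical_sets functions filter reals.

Set Implicit Arguments.
Unset Strict Implicit.
Unset Printing Implicit Defensive.

Import Order.TTheory GRing.Theory Num.Theory.

Local Open Scope classical_set_scope.
Local Open Scope order_scope.

HB.mixin Record TBLattice_isFrame d (L : Type) of Order.TBLattice d L := {
  bigjoin : set L -> L;
  bigjoin_supremum : forall A : set L, supremums A (bigjoin A);
  meet_bigjoin : forall (a : L) (A : set L),
    a `&` bigjoin A = bigjoin [set a `&` b | b in A]
}.

#[short(type="frameType")]
HB.structure Definition Frame d :=
  { L of Order.TBLattice d L & TBLattice_isFrame d L }.

Section FrameTheory.
Context {d : Order.disp_t} {L : frameType d}.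
Implicit Types (a b : L) (A : set L).

Definition bigmeet A : L := bigjoin (lbound A).

Lemma le_bigjoin A a : A a -> a <= bigjoin A.
Proof. by move=> Aa; have [+ _] := bigjoin_supremum A; apply. Qed.

Lemma ge_bigjoin A b : (forall a, A a -> a <= b) -> bigjoin A <= b.
Proof. by move=> ub; have [_] := bigjoin_supremum A; apply. Qed.

Lemma bigmeet_infimum A : infimums A (bigmeet A).
Proof.
split=> [a Aa|b lb_b]; last exact: le_bigjoin.
by apply: ge_bigjoin => b; apply.
Qed.

Definition pseudocompl a : L := bigjoin [set b | a `&` b = \bot].

Lemma meet_pseudocompl a : a `&` pseudocompl a = \bot.
Proof.
apply/le_anti; rewrite le0x andbT meet_bigjoin.
by apply: ge_bigjoin => _ [b /= -> <-].
Qed.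

Lemma pseudocomplS a b : a <= b -> pseudocompl b <= pseudocompl a.
Proof.
move=> ab; apply: le_bigjoin => /=; apply/le_anti; rewrite le0x andbT.
by rewrite -(meet_pseudocompl b) leI2.
Qed.

Lemma le_pseudocompl2 a : a <= pseudocompl (pseudocompl a).
Proof. by apply: le_bigjoin => /=; rewrite meetC meet_pseudocompl. Qed.

End FrameTheory.

Section FunFrame.
Context (T : Type) {d : Order.disp_t} (L : frameType d).

Lemma fun_le0x (f : T -> L) : (fun=> \bot) <= f.
Proof. by apply/lefP => x; exact: le0x. Qed.

Lemma fun_lex1 (f : T -> L) : f <= (fun=> \top).
Proof. by apply/lefP => x; exact: lex1. Qed.

HB.instance Definition _ :=
  Order.hasBottom.Build FunOrder.fun_display (T -> L) fun_le0x.
HB.instance Definition _ :=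
  Order.hasTop.Build FunOrder.fun_display (T -> L) fun_lex1.

Definition fun_bigjoin (A : set (T -> L)) : T -> L :=
  fun x => bigjoin [set f x | f in A].

Lemma fun_bigjoin_supremum A : supremums A (fun_bigjoin A).
Proof.
split=> [f Af|g ub_g]; apply/lefP => x.
  by apply: le_bigjoin; exists f.
by apply: ge_bigjoin => _ [f Af <-]; move/lefP: (ub_g _ Af).
Qed.

Lemma fun_meet_bigjoin (f : T -> L) (A : set (T -> L)) :
  f `&` fun_bigjoin A = fun_bigjoin [set f `&` g | g in A].
Proof.
apply/funext => x; rewrite meetfE meet_bigjoin; congr bigjoin.
apply/seteqP; split=> [_ [_ [g Ag <-] <-]|_ [_ [g Ag <-] <-]].
  by exists (f `&` g) => //; exists g.
by exists (g x) => //; exists g.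
Qed.

HB.instance Definition _ :=
  TBLattice_isFrame.Build FunOrder.fun_display (T -> L)
    fun_bigjoin_supremum fun_meet_bigjoin.

End FunFrame.

Section UnitInterval.
Context {R : realType}.
Local Notation V := {i01 R}.
Local Open Scope ring_scope.

Lemma i01_le0x (v : V) : (0%:i01 : V) <= v.
Proof. by rewrite -num_le /=. Qed.

Lemma i01_lex1 (v : V) : v <= (1%:i01 : V).
Proof. by rewrite -num_le /=. Qed.

HB.instance Definition _ := Order.hasBottom.Build _ V i01_le0x.
HB.instance Definition _ := Order.hasTop.Build _ V i01_lex1.

Lemma i01_has_ubound (A : set V) : has_ubound [set v%:num | v in A].
Proof. by exists 1 => _ [v _ <-]. Qed.

Lemma i01_sup_ge0 (A : set V) : 0 <= sup [set v%:num | v in A].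
Proof.
have [->|/set0P[v Av]] := eqVneq A set0; first by rewrite image_set0 sup0.
by apply: (@le_trans _ _ v%:num) => //; apply: ub_le_sup;
  [exact: i01_has_ubound|exists v].
Qed.

Lemma i01_sup_le1 (A : set V) : sup [set v%:num | v in A] <= 1.
Proof.
have [->|/set0P[v Av]] := eqVneq A set0; first by rewrite image_set0 sup0.
by apply: ge_sup; [exists v%:num, v|move=> _ [w _ <-]].
Qed.

(* The empty join is 0 because [sup set0 = 0] in a realType. *)
Definition i01_bigjoin (A : set V) : V := Itv01 (i01_sup_ge0 A) (i01_sup_le1 A).

Lemma i01_bigjoin_supremum A : supremums A (i01_bigjoin A).
Proof.
split=> [v Av|w ub_w]; rewrite -num_le /=.
  by apply: ub_le_sup; [exact: i01_has_ubound|exists v].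
have [->|/set0P[v Av]] := eqVneq A set0; first by rewrite image_set0 sup0.
apply: ge_sup; first by exists v%:num, v.
by move=> _ [u /ub_w + <-]; rewrite -num_le.
Qed.

Lemma i01_meet_bigjoin (v : V) (A : set V) :
  (v `&` i01_bigjoin A = i01_bigjoin [set v `&` w | w in A])%O.
Proof.
apply/le_anti/andP; split; last first.
  have [_] := i01_bigjoin_supremum [set (v `&` w)%O | w in A]; apply.
  move=> _ [w Aw <-]; apply: leI2 => //.
  by have [+ _] := i01_bigjoin_supremum A; apply.
have [ubS _] := i01_bigjoin_supremum [set (v `&` w)%O | w in A].
have [[w Aw vw]|nAv] := pselect (exists2 w, A w & v <= w).
  apply: (le_trans (leIl _ _)); apply: ubS.
  by exists w => //; apply/meet_idPl.
apply: (le_trans (leIr _ _)).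
have [_] := i01_bigjoin_supremum A; apply=> w Aw; apply: ubS.
exists w => //; apply/meet_idPr; rewrite leNgt; apply/negP => /ltW vw.
by apply: nAv; exists w.
Qed.

HB.instance Definition _ := TBLattice_isFrame.Build _ V
  i01_bigjoin_supremum i01_meet_bigjoin.

Definition i01_mul (s t : V) : V := (s%:num * t%:num)%:i01.

(* [i01_div t s] is t (/) s, the residual of multiplication by s. *)
Definition i01_div (t s : V) : V :=
  if s == 0%:i01 then 1%:i01 else (Num.min (t%:num / s%:num) 1)%:i01.

Definition indic01 {T : Type} (A : set T) : T -> V :=
  fun x => if x \in A then 1%:i01 else 0%:i01.

Lemma indic01_0 T : indic01 (@set0 T) = \bot%O.
Proof. by apply/funext => x; rewrite /indic01 in_set0. Qed.

Lemma indic01_T T : indic01 [set: T] = \top%O.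
Proof. by apply/funext => x; rewrite /indic01 in_setT. Qed.

Lemma indic01S T (A B : set T) : A `<=` B -> (indic01 A <= indic01 B)%O.
Proof.
move=> AB; apply/lefP => x; rewrite /indic01.
case: ifPn => [/set_mem/AB/mem_set ->//|_]; exact: i01_le0x.
Qed.

Lemma indic01I T (A B : set T) :
  indic01 (A `&` B) = (indic01 A `&` indic01 B)%O.
Proof.
apply/funext => x; rewrite meetfE /indic01 in_setI.
case: (x \in A); case: (x \in B); rewrite /= ?meetxx //.
- by apply/esym/meet_idPr; exact: i01_le0x.
- by apply/esym/meet_idPl; exact: i01_le0x.
Qed.

End UnitInterval.

Record lfilter {d : Order.disp_t} (L : tbLatticeType d) := LFilter {
  lfset :> L -> Prop;
  lfilter_nonempty : lfset !=set0;
  lfilterI : forall a b, lfset a -> lfset b -> lfset (a `&` b);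
  lfilterS : forall a b, a <= b -> lfset a -> lfset b;
  lfilter_proper : ~ lfset \bot
}.

Section LatticeFilters.
Context {d : Order.disp_t} {L : tbLatticeType d}.
Implicit Types (F G : lfilter L) (D : set (lfilter L)).

Lemma lfilterT F : F \top.
Proof. by have [a Fa] := lfilter_nonempty F; apply: lfilterS Fa; exact: lex1. Qed.

Lemma lfilter_eq F G : (F : set L) = G -> F = G.
Proof.
case: F G => [F F1 F2 F3 F4] [G G1 G2 G3 G4] /= FG; move: F1 F2 F3 F4.
by rewrite FG => *; congr LFilter; exact: Prop_irrelevance.
Qed.

Program Definition lfilter_bigcap D (D0 : D !=set0) : lfilter L :=
  @LFilter d L (\bigcap_(F in D) (F : set L)) _ _ _ _.
Next Obligation. by move=> D _; exists \top => F _; exact: lfilterT. Qed.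
Next Obligation.
by move=> D _ a b Da Db F DF; apply: lfilterI; [exact: Da|exact: Db].
Qed.
Next Obligation. by move=> D _ a b ab Da F DF; exact: lfilterS ab (Da F DF). Qed.
Next Obligation. by move=> D [F DF] /(_ F DF); exact: lfilter_proper. Qed.

End LatticeFilters.

Section ConvergenceFrames.
Context {d : Order.disp_t} {L : frameType d}.
Implicit Types (F G : lfilter L) (lim : lfilter L -> L).

(* The filter F** generated by the double pseudocomplements of elements of F. *)
Program Definition lfilter2 F : lfilter L :=
  @LFilter d L
    [set a | exists2 m, F m & pseudocompl (pseudocompl m) <= a] _ _ _ _.
Next Obligation.
by move=> F; exists \top, \top; [exact: lfilterT|exact: lex1].
Qed.
Next Obligation.
move=> F a b [m Fm ma] [n Fn nb]; exists (m `&` n); first exact: lfilterI.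
by rewrite lexI; apply/andP; split; [apply: le_trans ma|apply: le_trans nb];
  do 2!apply: pseudocomplS; [exact: leIl|exact: leIr].
Qed.
Next Obligation. by move=> F a b ab [m Fm ma]; exists m => //; exact: le_trans ab. Qed.
Next Obligation.
move=> F [m Fm m0]; apply: (@lfilter_proper _ _ F).
by apply: lfilterS Fm; exact: le_trans (le_pseudocompl2 m) m0.
Qed.

Definition monotone_lim lim :=
  forall F G, (F : set L) `<=` G -> lim F <= lim G.

Definition pseudocompl2_regular lim := forall F, lim F = lim (lfilter2 F).

Definition lim_adh lim (l : L) : L :=
  bigjoin [set lim H | H in
    [set H : lfilter L | forall h m, H h -> l <= m -> h `&` m != \bot]].

Definition centered lim := forall l, l <= lim_adh lim l.

Definition lim_bigcap lim := forall (D : set (lfilter L)) (D0 : D !=set0),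
  lim (lfilter_bigcap D0) = bigmeet [set lim F | F in D].

End ConvergenceFrames.

Program Definition pfilter_bigcap {X : Type} (D : set (pfilter_on X))
    (D0 : D !=set0) : pfilter_on X :=
  PFilterPack (\bigcap_(F in D) (F : set_system X)) _.
Next Obligation.
move=> X D [F0 DF0]; split; first by move=> /(_ F0 DF0); exact: filter_not_empty.
split=> [F _|A B DA DB F DF|A B AB DA F DF]; first exact: filterT.
  by apply: filterI; [exact: DA|exact: DB].
exact: filterS AB (DA F DF).
Qed.

Section ApproachSpaces.
Context {R : realType} {X : Type}.
Local Notation V := {i01 R}.
Implicit Types (lam : pfilter_on X -> X -> V) (A : set X).

Definition is_convergence_approach lam :=
  (forall F G : pfilter_on X, (F : set_system X) `<=` G -> lam F <= lam G) /\
  (forall x, lam (PFilterPack (principal_filter x)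
                    (principal_filter_proper x)) x = 1%:i01%R).

Definition approach_adh lam A (x : X) : V :=
  bigjoin [set lam U x | U in [set U : pfilter_on X | UltraFilter U /\ U A]].

(* A^(e) *)
Definition approach_enlarge lam A (e : V) : set X :=
  [set x | e <= approach_adh lam A x].

Definition is_preapproach lam :=
  is_convergence_approach lam /\
  forall (D : set (pfilter_on X)) (D0 : D !=set0),
    lam (pfilter_bigcap D0) = bigmeet [set lam F | F in D].

Definition is_approach lam :=
  is_preapproach lam /\
  forall A x (e : V),
    i01_mul (approach_adh lam (approach_enlarge lam A e) x) e
      <= approach_adh lam A x.

(* {A | theta_A in F}, the filter on X induced by a filter F on the frame V^X. *)
Program Definition indic_trace (F : lfilter (X -> V)) : pfilter_on X :=
  PFilterPack [set A : set X | F (indic01 A)] _.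
Next Obligation.
move=> F; split; first by rewrite /= indic01_0; exact: lfilter_proper.
split=> [|A B FA FB|A B AB]; rewrite /= ?indic01_T ?indic01I.
- exact: lfilterT.
- exact: lfilterI.
- by apply: lfilterS; exact: indic01S.
Qed.

Definition approach_lim lam : lfilter (X -> V) -> X -> V :=
  fun F => lam (indic_trace F).

(* [indic01 A] is here the endofunction of V = [0, 1], with A a subset of V. *)
Definition star_trace (h : X -> V) (G : lfilter (X -> V)) : set (set V) :=
  [set A | G (indic01 A \o h)].

End ApproachSpaces.

(* limsup of the identity of [0, 1] along a family S of subsets. *)
Definition limsup_id {R : realType} (S : set (set {i01 R})) : {i01 R} :=
  bigmeet [set bigjoin A | A in S].

(* Main.v *)
(* In the frame [X -> V] the double pseudocomplement of f is the indicator of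
   its support. Hence F** depends only on the filter {A | theta_A in F} on X,
   so the **-regular limits are exactly those of the form [approach_lim lam],
   with lam U the limit of the filter generated by the indicators of members
   of U; for these adh f is the adherence of the support of f. The approach
   inequality and the limsup inequality are then matched by residuation: for
   e < limsup, G meshes with {adh f >= e}; and if an ultrafilter contains
   {adh f >= e}, the limsup along it is at least e. *)
Require Import Defs.
From mathcomp Require Import all_boot all_order all_algebra.
From mathcomp Require Import interval_inference.
From mathcomp Require Import boolp classical_sets functions filter reals.
Import Order.TTheory.
Local Open Scope order_scope.

Import GRing.Theory Num.Theory.
Local Open Scope classical_set_scope.
Local Open Scope order_scope.

(** * Residuation and density in the unit interval *)

Section UnitIntervalQuantale.
Context {R : realType}.
Local Notation V := {i01 R}.
Implicit Types s t v e : V.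

Lemma i01_mulC s t : i01_mul s t = i01_mul t s.
Proof. by apply/val_inj; rewrite /= mulrC. Qed.

Lemma i01_mul_le2 s s' t t' :
  s <= s' -> t <= t' -> i01_mul s t <= i01_mul s' t'.
Proof.
by rewrite -!num_le /= => ss tt; apply: ler_pM.
Qed.

Lemma le_i01_div t s v : (t <= i01_div v s) = (i01_mul t s <= v).
Proof.
rewrite /i01_div; case: eqP => [->|/eqP s0].
  (* For [s = 0] both sides hold: the quotient is 1 by convention and the product is 0. *)
  by rewrite -!num_le /= mulr0; apply/idP/idP => _.
have sgt0 : (0 < s%:num)%R by
    rewrite lt_neqAle eq_sym andbC /= ge0 /=
            (inj_eq val_inj s 0%:i01%R).
rewrite -!num_le /= le_min le1 andbT ler_pdivlMr //.
Qed.

Lemma i01_dense s t : s < t -> exists2 e, s < e & e < t.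
Proof.
rewrite -num_lt => st.
have [se et] := midf_lt st.
have e0 : (0 <= (s%:num + t%:num) / 2 :> R)%R by rewrite (le_trans _ (ltW se)).
have e1 : ((s%:num + t%:num) / 2 <= 1 :> R)%R by rewrite (le_trans (ltW et)).
by exists (Itv01 e0 e1); rewrite -num_lt.
Qed.

(** Continuity of the product from below: if [s] exceeded the residual of [v] by [t], density would
    give an [e] strictly between them, against the hypothesis. *)
Lemma i01_mul_le_lt t s v :
  (forall e, e < s -> i01_mul t e <= v) -> i01_mul t s <= v.
Proof.
move=> H; rewrite i01_mulC -le_i01_div leNgt; apply/negP => /i01_dense[e ve es].
by move: (H e es); rewrite i01_mulC -le_i01_div leNgt ve.
Qed.

Lemma i01_meet_neq0 s t : (s `&` t != \bot) = (s != \bot) && (t != \bot).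
Proof.
rewrite -!lt0x; have [st|ts] := leP s t.
  by apply/idP/andP => [s0|[]//]; split=> //; exact: lt_le_trans st.
by apply/idP/andP => [t0|[]//]; split=> //; exact: lt_trans ts.
Qed.

End UnitIntervalQuantale.

(** * Supports and pseudocomplements of functions *)

Section FunctionFrame.
Context {R : realType} {X : Type}.
Local Notation V := {i01 R}.
Implicit Types (f g : X -> V) (A B : set X).

Definition fsupp f : set X := [set x | f x != \bot].

Lemma i01_1neq0 : (1%:i01%R : V) != \bot.
Proof. by rewrite -lt0x -num_lt /=. Qed.

Lemma fsupp_indic A : fsupp (indic01 A : X -> V) = A.
Proof.
apply/seteqP; split=> x; rewrite /fsupp /indic01 /=.
  by case: ifPn => [/set_mem//|_]; rewrite eqxx.
by move=> /mem_set ->; exact: i01_1neq0.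
Qed.

Lemma indic01_le A f : (indic01 A <= f) <-> A `<=` [set x | f x = \top].
Proof.
split=> [/lefP Af x Ax /=|Af].
  apply/le_anti; rewrite lex1 /=.
  by have := Af x; rewrite /indic01 mem_set.
apply/lefP => x; rewrite /indic01.
by case: ifPn => [/set_mem/Af /= ->|_]; [exact: lex1|exact: le0x].
Qed.

Lemma le_indic01 A f : (f <= indic01 A) <-> fsupp f `<=` A.
Proof.
split=> [/lefP fA x fx|fA].
  apply: contrapT => nAx; move: (fA x).
  by rewrite /indic01 memNset// lex0; exact/negP.
apply/lefP => x; rewrite /indic01.
case: ifPn => [_|/negP nA]; first exact: lex1.
rewrite lex0; apply: contrapT => /negP fx.
by apply: nA; apply/mem_set/fA.
Qed.

Lemma fun_meet_neq0 f g :
  f `&` g != \bot <-> (fsupp f `&` fsupp g)%classic !=set0.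
Proof.
split=> [fg|[x []]].
  apply/set0P; apply: contra fg => /eqP fg0; apply/eqP/funext => x.
  apply/eqP; rewrite -[_ == _]negbK meetfE i01_meet_neq0; apply/negP => /andP fgx.
  by have : (fsupp f `&` fsupp g)%classic x by []; rewrite fg0.
rewrite /fsupp /= => fx gx; apply/eqP => /(congr1 (@^~ x)) /eqP; apply/negP.
by rewrite meetfE i01_meet_neq0 fx.
Qed.

(** Functions disjoint from [f] are those vanishing on its support; the largest of them is this
    indicator. *)
Lemma fun_pseudocompl f : pseudocompl f = indic01 (~` fsupp f).
Proof.
apply/le_anti/andP; split.
  apply: ge_bigjoin => g /= fg0; apply/le_indic01 => x gx fx.
  by have /eqP := fg0; apply/negP/fun_meet_neq0; exists x.
apply: le_bigjoin => /=; apply/eqP/negPn/negP => /fun_meet_neq0[x].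
by rewrite fsupp_indic => -[].
Qed.

Lemma fun_pseudocompl2 f :
  pseudocompl (pseudocompl f) = indic01 (fsupp f).
Proof. by rewrite !fun_pseudocompl fsupp_indic setCK. Qed.

End FunctionFrame.

(** * Filters on [X] against filters on the function frame *)

Section FilterCorrespondence.
Context {R : realType} {X : Type}.
Local Notation V := {i01 R}.
Implicit Types (F G : lfilter (X -> V)) (U : pfilter_on X) (A : set X).

Lemma pfilter_eq (U W : pfilter_on X) : (U : set_system X) = W -> U = W.
Proof.
case: U W => [U PU] [W PW] /= UW; move: PU; rewrite UW => PU.
by congr PFilterPack; exact: Prop_irrelevance.
Qed.

(* [f = \top] on a member A of U means theta_A <= f. *)
Program Definition indic_filter U : lfilter (X -> V) :=
  @LFilter _ (X -> V) [set f | U [set x | f x = \top]] _ _ _ _.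
Next Obligation.
by move=> U; exists \top => /=; apply: filterS filterT.
Qed.
Next Obligation.
move=> U f g Uf Ug; apply: filterS (filterI Uf Ug) => x /= [fx gx].
by rewrite meetfE fx gx meetxx.
Qed.
Next Obligation.
move=> U f g /lefP fg; apply: filterS => x /= fx.
by apply/le_anti; rewrite lex1 -fx fg.
Qed.
Next Obligation.
move=> U /= U0; apply: (@filter_not_empty _ U _); apply: filterS U0 => x /=.
by move=> /esym/eqP; rewrite (negbTE i01_1neq0).
Qed.

Lemma indic_filterE U A : indic_filter U (indic01 A) <-> U A.
Proof.
rewrite /indic_filter /=; split; apply: filterS => x /=.
  by move=> Ax; rewrite -[A](@fsupp_indic R) /fsupp /= Ax i01_1neq0.
by move=> Ax; rewrite /indic01 mem_set.
Qed.

Lemma indic_filterK U : indic_trace (indic_filter U) = U.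
Proof.
by apply/pfilter_eq/seteqP; split=> A /=; move/indic_filterE.
Qed.

(** Both filters are generated by the indicators in [F]: an indicator is its own double
    pseudocomplement, and [m] in [F] puts the indicator of its support in [F]. *)
Lemma indic_filter_trace F : indic_filter (indic_trace F) = lfilter2 F.
Proof.
apply/lfilter_eq/seteqP; split=> f /=.
  move=> Ff; exists (indic01 [set x | f x = \top]) => //.
  by rewrite fun_pseudocompl2 fsupp_indic; apply/indic01_le.
move=> [m Fm]; rewrite fun_pseudocompl2 => /indic01_le mf.
by apply: lfilterS Fm; apply/le_indic01.
Qed.

Lemma indic_trace2 F : indic_trace (lfilter2 F) = indic_trace F.
Proof. by rewrite -indic_filter_trace indic_filterK. Qed.

Lemma indic_trace_bigcap (D : set (lfilter (X -> V))) (D0 : D !=set0)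
    (D0' : [set indic_trace F | F in D] !=set0) :
  indic_trace (lfilter_bigcap D0) = pfilter_bigcap D0'.
Proof.
apply/pfilter_eq/seteqP; split=> A /=.
  by move=> DA _ [F DF <-]; exact: DA.
by move=> DA F DF; apply: (DA (indic_trace F)); exists F.
Qed.

Lemma indic_filter_bigcap (D : set (pfilter_on X)) (D0 : D !=set0)
    (D0' : [set indic_filter U | U in D] !=set0) :
  indic_filter (pfilter_bigcap D0) = lfilter_bigcap D0'.
Proof.
apply/lfilter_eq/seteqP; split=> f /=.
  by move=> Df _ [U DU <-]; exact: Df.
by move=> Df U DU; apply: (Df (indic_filter U)); exists U.
Qed.

(** The traces on [A] of the members of [U] generate the filter [within A U], proper by the meshing
    hypothesis, and any ultrafilter above it will do. *)
Lemma ultra_extension U A : (forall B, U B -> (B `&` A)%classic !=set0) ->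
  exists W : pfilter_on X, [/\ UltraFilter W, (U : set_system X) `<=` W & W A].
Proof.
move=> UA.
have PW : ProperFilter (within A U).
  split; last exact: within_filter.
  by move=> /UA[x [/= + Ax]]; apply.
have [W [UW sW]] := ultraFilterLemma PW.
exists (PFilterPack W (@ultra_proper _ _ UW)); split => //=.
  by move=> B UB; apply: sW; apply: filterS UB => x Bx _.
by apply: sW; rewrite /within /=; apply: (filterS _ filterT) => x _.
Qed.

End FilterCorrespondence.

(** * Adherence of a function as adherence of its support *)

Section ApproachAdherence.
Context {R : realType} {X : Type}.
Local Notation V := {i01 R}.
Variable lam : pfilter_on X -> X -> V.
Hypothesis lam_mono :
  forall F G : pfilter_on X, (F : set_system X) `<=` G -> lam F <= lam G.

Lemma approach_lim_adh (f : X -> V) :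
  lim_adh (approach_lim lam) f = approach_adh lam (fsupp f).
Proof.
apply/le_anti/andP; split.
  apply: ge_bigjoin => _ [H Hf <-]; apply/lefP => x.
  (* Since [H] meshes with [f], its trace meshes with the support of [f], so some ultrafilter [W]
     contains both. *)
  have [A HA|W [UW sW Wf]] := @ultra_extension X (indic_trace H) (fsupp f).
    by have := Hf _ _ HA (lexx f) => /fun_meet_neq0; rewrite fsupp_indic.
  apply: (@le_trans _ _ (lam W x)); first exact/lefP/lam_mono.
  by apply: le_bigjoin; exists W.
apply/lefP => x; apply: ge_bigjoin => _ [U [UU Uf] <-].
apply: le_bigjoin; exists (lam U); last by [].
exists (indic_filter U); last by rewrite /approach_lim indic_filterK.
move=> h m /= Uh /lefP fm; apply/fun_meet_neq0.
have [y [/= hy fy]] := filter_ex (filterI Uh Uf).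
exists y; rewrite /fsupp /=; split; first by rewrite hy; exact: i01_1neq0.
by rewrite -lt0x (lt_le_trans _ (fm y))// lt0x.
Qed.

End ApproachAdherence.

(** * The two directions of the equivalence *)

Section Characterization.
Context {R : realType} {X : Type}.
Local Notation V := {i01 R}.
Implicit Types (lam : pfilter_on X -> X -> V) (lim : lfilter (X -> V) -> X -> V).
Implicit Types (f : X -> V) (G : lfilter (X -> V)) (e : V).

Definition star_division lim := forall f G x,
  lim G x <= i01_div (lim_adh lim f x) (limsup_id (star_trace (lim_adh lim f) G)).

Lemma approach_star_division lam :
  is_approach lam -> star_division (approach_lim lam).
Proof.
move=> [[[mono _] _] adh_enl] f G x; rewrite le_i01_div.
apply: i01_mul_le_lt => e; rewrite approach_lim_adh//.
set A := fsupp f => es.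
have [B GB|W [UW GW We]] :=
    @ultra_extension X (indic_trace G) (approach_enlarge lam A e).
  (* If [B] missed the enlargement, the adherence would be below [e] on [B]; then [[set v | v < e]]
     would lie in the star trace and force the limsup down to [e]. *)
  apply: contrapT => /nonemptyPn Be0.
  have : limsup_id (star_trace (approach_adh lam A) G) <= e.
    have [lb _] := bigmeet_infimum
      [set bigjoin C | C in star_trace (approach_adh lam A) G].
    apply: le_trans (lb _ (ex_intro2 _ _ [set v | v < e] _ erefl)) _.
      apply: lfilterS GB; apply/indic01_le => y By /=.
      rewrite /indic01 /=; case: ifPn => // /negP nlt; exfalso; apply: nlt.
      apply/mem_set => /=; rewrite ltNge; apply/negP => ey.
      by have : (B `&` approach_enlarge lam A e)%classic y by []; rewrite Be0.
    by apply: ge_bigjoin => v /= /ltW.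
  by rewrite leNgt es.
apply: le_trans (adh_enl A x e); apply: i01_mul_le2 => //.
apply: (@le_trans _ _ (lam W x)); first exact/lefP/mono.
by apply: le_bigjoin; exists W.
Qed.

Lemma approach_adh_enlarge lam :
    (forall F G : pfilter_on X, (F : set_system X) `<=` G -> lam F <= lam G) ->
    star_division (approach_lim lam) ->
  forall A x e,
    i01_mul (approach_adh lam (approach_enlarge lam A e) x) e
      <= approach_adh lam A x.
Proof.
move=> mono sd A x e; rewrite -le_i01_div.
apply: ge_bigjoin => _ [U [UU Ue] <-].
(* With these choices [lim_adh] becomes the adherence of [A] and the limit becomes [lam U]. *)
have := sd (indic01 A) (indic_filter U) x.
rewrite approach_lim_adh// fsupp_indic /approach_lim indic_filterK.
rewrite !le_i01_div; apply: le_trans; apply: i01_mul_le2 => //.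
have [_] := bigmeet_infimum [set bigjoin C | C in
  star_trace (approach_adh lam A) (indic_filter U)].
apply=> _ [C UC <-].
have {}UC : U [set y | indic01 C (approach_adh lam A y) = \top] := UC.
(* Each [C] in the star trace contains an adherence value at a point of the enlargement, so its join
   is at least [e]. *)
have [y [/= Cy ey]] := @filter_ex _ U _ _ (filterI UC Ue).
apply: le_trans ey _; apply: le_bigjoin; apply: contrapT => nC.
move: Cy; rewrite /indic01 memNset// => /esym/eqP.
by rewrite (negbTE i01_1neq0).
Qed.

Lemma approach_lim_axioms lam : is_approach lam ->
  [/\ pseudocompl2_regular (approach_lim lam), centered (approach_lim lam)
    & lim_bigcap (approach_lim lam)].
Proof.
move=> [[[mono pt] cap] _]; split.
- by move=> F; rewrite /approach_lim indic_trace2.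
- move=> f; rewrite approach_lim_adh//; apply/lefP => x.
  have [->|fx] := eqVneq (f x) \bot; first exact: le0x.
  (* The principal ultrafilter at [x] contains the support of [f] and has limit 1 at [x]. *)
  apply: (@le_trans _ _ (lam (PFilterPack _ (principal_filter_proper x)) x)).
    by rewrite pt; exact: lex1.
  apply: le_bigjoin; exists (PFilterPack _ (principal_filter_proper x)) => //.
  split; first exact: principal_filter_ultra.
  by apply/principal_filterP.
- move=> D D0.
  have D0' : [set indic_trace F | F in D] !=set0.
    by have [F DF] := D0; exists (indic_trace F), F.
  rewrite /approach_lim (indic_trace_bigcap _ D0 D0') cap; congr bigmeet.
  by rewrite image_comp.
Qed.

Lemma approach_lim_indic_filter lim : pseudocompl2_regular lim ->
  lim = approach_lim (fun U => lim (indic_filter U)).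
Proof.
by move=> reg; apply/funext => G; rewrite /approach_lim indic_filter_trace -reg.
Qed.

Lemma indic_filter_preapproach lim : monotone_lim lim ->
    pseudocompl2_regular lim -> centered lim -> lim_bigcap lim ->
  is_preapproach (fun U => lim (indic_filter U)).
Proof.
move=> mono reg cen cap; split; first split.
- by move=> U W UW; apply: mono => f /=; exact: UW.
- move=> x; apply/le_anti; rewrite i01_lex1 /=.
  (* Centeredness makes the adherence of the singleton's indicator 1 at [x]. By regularity each [H]
     in that join may be replaced by its double-pseudocomplement filter, which meshing places inside
     [indic_filter] of the principal filter. *)
  have /lefP/(_ x) := cen (indic01 [set x]).
  rewrite {1}/indic01 mem_set// => /le_trans; apply.
  apply: ge_bigjoin => _ [_ [H Hx <-] <-]; rewrite reg -indic_filter_trace.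
  apply/lefP/mono => f /= Hf; apply/principal_filterP => /=.
  have /fun_meet_neq0[y] := Hx _ _ Hf (lexx _).
  by rewrite !fsupp_indic => -[/= fy <-].
- move=> D D0.
  have D0' : [set (indic_filter U : lfilter (X -> V)) | U in D] !=set0.
    by have [U DU] := D0; exists (indic_filter U), U.
  by rewrite (indic_filter_bigcap _ D0 D0') cap image_comp.
Qed.

End Characterization.

Theorem theorem30 (R : realType) (X : Type)
    (lim : lfilter (X -> {i01 R}) -> (X -> {i01 R}))
    (lim_mono : monotone_lim lim) :
  (exists lam : pfilter_on X -> X -> {i01 R},
     is_approach lam /\ lim = approach_lim lam) <->
  [/\ pseudocompl2_regular lim,
      centered lim,
      lim_bigcap lim &
      forall (f : X -> {i01 R}) (G : lfilter (X -> {i01 R})) (x : X),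
        lim G x <=
          i01_div (lim_adh lim f x)
                  (limsup_id (star_trace (lim_adh lim f) G))].
Proof.
split=> [[lam [lamA ->]]|[reg cen cap sd]].
  have [reg cen cap] := approach_lim_axioms _ lamA.
  by split=> //; exact: approach_star_division.
(* Regularity determines [lim] from its values on the filters [indic_filter U], which dictates the
   choice of [lam]. *)
have limE := approach_lim_indic_filter _ reg.
have pre := indic_filter_preapproach _ lim_mono reg cen cap.
exists (fun U => lim (indic_filter U)); split => //; split => //.
by apply: approach_adh_enlarge; [case: pre => -[]|rewrite -limE].
Qed.
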